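(* Let $G$ be a finite simple graph, $\theta$ a real number, and $X$ a $\theta$-barrier set in $G$. Then $A_{\theta}(G)\subseteq X$. In particular, $A_{\theta}(G)$ is the (inclusionwise) minimal $\theta$-barrier set in $G$; that is, $A_\theta(G)$ is itself a $\theta$-barrier set and is contained in every $\theta$-barrier set of $G$.
   Context: All graphs are finite and simple. An $r$-matching in a graph $G$ is a set of $r$ edges, no two of which share a vertex; $p(G,r)$ is the number of $r$-matchings in $G$, with $p(G,0)=1$. For $G$ with $n$ vertices the matching polynomial is $\mu(G,x)=\sum_{r=0}^{\lfloor n/2\rfloor}(-1)^r p(G,r)x^{n-2r}$ (so it equals $1$ for the graph with no vertices). For a real number $\theta$, $\mathrm{mult}(\theta,G)$ is the multiplicity of $\theta$ as a root of $\mu(G,x)$ ($0$ if $\theta$ is not a root). $G\setminus X$ is the graph obtained from $G$ by deleting the vertices in $X$ and all incident edges; $G\setminus u=G\setminus\{u\}$. A vertex $u$ of $G$ is $\theta$-essential if $\mathrm{mult}(\theta,G\setminus u)=\mathrm{mult}(\theta,G)-1$. A vertex is $\theta$-special if it is not $\theta$-essential but is adjacent to some $\theta$-essential vertex; $A_\theta(G)$ is the set of $\theta$-special vertices of $G$. A graph is $\theta$-critical if all its vertices are $\theta$-essential and the multiplicity of $\theta$ as a root of its matching polynomial is $1$. ''Component'' means connected component, and $c_\theta(G)$ is the number of $\theta$-critical components of $G$. A $\theta$-barrier set in $G$ is a set $X\subseteq V(G)$ with $\mathrm{mult}(\theta,G)=c_\theta(G\setminus X)-|X|$. *)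

(* Defs.v *)
From mathcomp Require Import all_boot all_order all_algebra reals.

Set Implicit Arguments.
Unset Strict Implicit.
Unset Printing Implicit Defensive.

Import GRing.Theory.
Local Open Scope ring_scope.

(* A graph is given by a symmetric irreflexive relation e on a finite type T
   together with a vertex set S : {set T}, and stands for the subgraph of
   (T, e) induced on S.  The graph (T, e) itself is S = [set: T], and deleting
   the vertices of X from the graph on S gives the graph on S :\: X.
   Symmetry and irreflexivity are hypotheses of the theorem. *)
Section Graph.
Variables (T : finType) (e : rel T).
Implicit Types (S X C : {set T}) (u v : T).

Definition edges S : {set {set T}} :=
  [set [set x; y] | x in S, y in S & e x y].

Definition is_matching S (M : {set {set T}}) : bool :=
  (M \subset edges S) && trivIset M.

Definition num_matchings S (r : nat) : nat :=
  #|[set M : {set {set T}} | is_matching S M & #|M| == r]|.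

Definition adj_in S : rel T := [rel x y | [&& x \in S, y \in S & e x y]].

Definition components S : {set {set T}} :=
  equivalence_partition (connect (adj_in S)) S.

Variables (R : realType) (theta : R).

Definition matching_poly S : {poly R} :=
  \sum_(r < (#|S| %/ 2).+1)
    ((-1) ^+ r * (num_matchings S r)%:R) *: 'X^(#|S| - 2 * r).

Definition mult S : nat := mup theta (matching_poly S).

(* mult (S :\ u) = mult S - 1, without truncated subtraction: no vertex is
   essential when mult S = 0. *)
Definition essential S u : bool :=
  (u \in S) && ((mult (S :\ u) + 1)%N == mult S).

Definition special S u : bool :=
  [&& u \in S, ~~ essential S u & [exists v, e u v && essential S v]].

Definition special_set S : {set T} := [set u | special S u].

Definition critical S : bool :=
  [forall u in S, essential S u] && (mult S == 1%N).

Definition num_critical S : nat := #|[set C in components S | critical C]|.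

(* The difference is taken in int. *)
Definition barrier S X : Prop :=
  X \subset S /\ (mult S)%:Z = (num_critical (S :\: X))%:Z - #|X|%:Z.

End Graph.

(* Main.v *)
Require Import Defs.
From mathcomp Require Import all_boot all_order all_algebra reals.
From mathcomp Require Import zify ring.

(** Write mu for the matching polynomial, m for the multiplicity of theta in
    it, and say that u is positive in S when m (S :\ u) = m S + 1.

    Two facts about matching polynomials carry the proof. The first is the
    recursion mu_rec, which expands mu at a vertex u: either u is unmatched or
    it is matched to one of its neighbours. The second is positivity. The
    recursion makes mu (S :\ u) * mu (S :\ v) - mu S * mu (S :\ u :\ v) a sum
    of squares, of the polynomials mu (S :\: P) for P a path from u to v
    (Heilmann and Lieb). Over the reals squares cannot cancel, so a power of
    X - theta that divides such a sum divides every summand accordingly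
    (sum_sqr_dvd). Consequences: deleting a vertex changes m by at most one; a
    vertex u is positive in S exactly when some neighbour of u is essential in
    S :\ u (positive_of_essential, essential_of_positive); and a special
    vertex is positive (special_positive).

    The heart of the matter is nonessential_trans. Call two essential vertices
    y, w of S related when y = w or w is not essential in S :\ y. This
    relation is transitive. If y, v and v, w were related but y, w were not,
    then the identity in path_gram would equate a polynomial in which theta
    has multiplicity 2 (m S) - 3 with twice the sum over paths P from v to y
    avoiding w of mu (S :\: P) * mu (S :\: P :\ w). But the sums of the
    squares of these two factors are known to vanish at theta to such orders
    that every product vanishes to order at least 2 (m S) - 2.

    Both classical ingredients of a Gallai-Edmonds theory follow from
    transitivity. Gallai's lemma (gallai): in a connected graph whose vertices
    are all essential, adjacent vertices are related, hence all are, so after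
    deleting one vertex no vertex is essential, and m must have dropped to 0.
    Stability (stability): deleting a special vertex u keeps the set of
    essential vertices. Indeed, u has two neighbours that are essential but
    unrelated in S :\ u, so each vertex w essential in S :\ u is unrelated to
    one of them; that neighbour makes u positive in S :\ w, whence w is
    essential in S.

    By stability the special vertices can be deleted one by one, each deletion
    raising m by one and leaving the other special vertices special. In the
    graph that remains, a component with an essential vertex has only
    essential vertices, so by Gallai's lemma m counts the critical components:
    the special vertices form a barrier. Conversely, the vertices of a barrier
    X are positive as they are deleted in turn, a special vertex outside X
    stays special all along, and no vertex is special once every component is
    critical or has m = 0. *)

Set Implicit Arguments.
Unset Strict Implicit.
Unset Printing Implicit Defensive.

Import Order.TTheory GRing.Theory Num.Theory.
Local Open Scope ring_scope.

(** * Divisibility of sums of squares *)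

Section Gram.
Variables (R : realFieldType) (theta : R).
Implicit Types (p q r : {poly R}).
Local Notation d := ('X - theta%:P).

Lemma dvdp_sum (I : finType) (P : pred I) (F : I -> {poly R}) q :
  (forall i, P i -> q %| F i) -> q %| \sum_(i | P i) F i.
Proof.
by move=> dF; elim/big_ind: _ => // x y; apply: dvdp_add.
Qed.

Lemma sum_sqr_root (s : seq {poly R}) :
  d %| \sum_(p <- s) p ^+ 2 -> {in s, forall p, d %| p}.
Proof.
rewrite dvdp_XsubCl rootE horner_sum psumr_eq0 => [/allP s0 p ps|p _].
  by have := s0 _ ps; rewrite dvdp_XsubCl /= horner_exp sqrf_eq0.
by rewrite horner_exp sqr_ge0.
Qed.

(** The values of the p at theta are reals whose squares sum to 0, so each p is
    divisible by X - theta; divide all of them by it and iterate. *)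
Lemma sum_sqr_dvd n (s : seq {poly R}) :
  d ^+ n.*2.+1 %| \sum_(p <- s) p ^+ 2 -> {in s, forall p, d ^+ n.+1 %| p}.
Proof.
elim: n => [|n IHn] ds p ps; first by rewrite expr1; apply: sum_sqr_root ps.
have ds' : {in s, forall p, d ^+ n.+1 %| p}.
  by apply: IHn; apply: dvdp_trans ds; apply: dvdp_exp2l; lia.
pose c q := q %/ d ^+ n.+1.
have cE q : q \in s -> q = c q * d ^+ n.+1 by move=> /ds' /divpK.
have sE : \sum_(q <- s) q ^+ 2 = (\sum_(q <- map c s) q ^+ 2) * d ^+ n.+1.*2.
  rewrite big_map mulr_suml; apply: eq_big_seq => q /cE {1}->.
  by rewrite exprMn -exprM muln2.
have dn0 m : d ^+ m != 0 by rewrite expf_neq0 // polyXsubC_eq0.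
rewrite [p]cE // exprS dvdp_mul2r //; apply: (@sum_sqr_root (map c s)).
  by rewrite -(dvdp_mul2r _ _ (dn0 n.+1.*2)) -sE -exprS.
exact: map_f.
Qed.

(** The entries a.1, a.2 form two vectors of polynomials, and p, r, q are the
    coefficients of the quadratic form that maps x, y to the squared length of
    x times the first vector plus y times the second.  A sum of squares is the
    case where the second vector is 0. *)
Definition gram p r q := exists s : seq ({poly R} * {poly R}),
  [/\ p = \sum_(a <- s) a.1 ^+ 2, r = \sum_(a <- s) a.1 * a.2 *+ 2
    & q = \sum_(a <- s) a.2 ^+ 2].

Lemma gram0 : gram 0 0 0.
Proof. by exists [::]; rewrite !big_nil. Qed.

Lemma gramD p r q p' r' q' :
  gram p r q -> gram p' r' q' -> gram (p + p') (r + r') (q + q').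
Proof.
move=> [s [-> -> ->]] [s' [-> -> ->]].
by exists (s ++ s'); rewrite !big_cat.
Qed.

Lemma gram_sum (I : finType) (P : pred I) (p r q : I -> {poly R}) :
  (forall i, P i -> gram (p i) (r i) (q i)) ->
  gram (\sum_(i | P i) p i) (\sum_(i | P i) r i) (\sum_(i | P i) q i).
Proof.
move=> g; elim/big_rec3: _ => [|i x y z /g]; [exact: gram0|exact: gramD].
Qed.

Lemma gram_sqr p q : gram (p ^+ 2) (p * q *+ 2) (q ^+ 2).
Proof. by exists [:: (p, q)]; rewrite !big_seq1. Qed.

Lemma gram_sos p r q : gram p r q -> gram p 0 0.
Proof.
move=> [s [-> _ _]]; exists [seq (a.1, 0) | a <- s]; rewrite !big_map /=.
by split=> //; rewrite big1 // => i _; rewrite ?mulr0 ?mul0rn ?expr0n.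
Qed.

Lemma sos_sum (I : finType) (P : pred I) (p : I -> {poly R}) :
  (forall i, P i -> gram (p i) 0 0) -> gram (\sum_(i | P i) p i) 0 0.
Proof.
move=> g; elim/big_ind: _ => // [|x y gx gy]; first exact: gram0.
by have := gramD gx gy; rewrite addr0.
Qed.

(** An analogue of the Cauchy-Schwarz inequality for orders of vanishing. *)
Lemma gram_dvd p r q i j : gram p r q ->
  d ^+ i.*2.+1 %| p -> d ^+ j.*2.+1 %| q -> d ^+ (i + j).+2 %| r.
Proof.
move=> [s [-> -> ->]] dp dq; rewrite big_seq; elim/big_ind: _ => [||a aS].
- exact: dvdp0.
- by move=> x y; apply: dvdp_add.
rewrite -scaler_nat dvdpZr ?pnatr_eq0 // -addSn -addnS exprD; apply: dvdp_mul.
  apply: (@sum_sqr_dvd i (map fst s)); last exact: map_f.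
  by rewrite big_map.
apply: (@sum_sqr_dvd j (map snd s)); last exact: map_f.
by rewrite big_map.
Qed.

Lemma sos_summand_dvd a p n : gram p 0 0 -> d ^+ n.*2.+1 %| a ^+ 2 + p ->
  d ^+ n.+1 %| a.
Proof.
move=> [s [-> _ _]] da; apply: (@sum_sqr_dvd n (a :: map fst s)).
  by rewrite big_cons big_map.
exact: mem_head.
Qed.

(** The order of vanishing of a sum of squares is even. *)
Lemma sos_dvd p n : gram p 0 0 -> d ^+ n.*2.+1 %| p -> d ^+ n.+1.*2 %| p.
Proof.
move=> [s [-> _ _]] da; rewrite big_seq; elim/big_ind: _ => [||a aS].
- exact: dvdp0.
- by move=> x y; apply: dvdp_add.
rewrite -muln2 exprM dvdp_exp2r //; apply: (@sum_sqr_dvd n (map fst s)).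
  by rewrite big_map.
exact: map_f.
Qed.
Lemma dvdp_deriv n p : d ^+ n %| p -> d ^+ n.-1 %| p^`().
Proof.
case: n => [|n] /=; first by rewrite !dvd1p.
move=> /divpK <-; rewrite derivM deriv_exp derivXsubC mul1r /=.
apply: dvdp_add; first by apply: dvdp_mull; apply: dvdp_exp2l.
by rewrite -mulr_natl !dvdp_mull.
Qed.

Lemma dvdp_of_deriv n p :
  d ^+ n.+1 %| p -> d ^+ n.+1 %| p^`() -> d ^+ n.+2 %| p.
Proof.
move=> /divpK <-; set q := _ %/ _.
have dn0 m : d ^+ m != 0 by rewrite expf_neq0 // polyXsubC_eq0.
rewrite derivM deriv_exp derivXsubC mul1r /= dvdp_addr; last exact: dvdp_mull.
rewrite mulrnAr -scaler_nat dvdpZr ?pnatr_eq0 //.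
by rewrite {1}exprS dvdp_mul2r // => dq; rewrite exprS dvdp_mul2r.
Qed.
End Gram.

(** Linear arithmetic with multiplicities as opaque atoms: comparing them up to
    conversion would unfold the matching polynomials. *)
Ltac mult_lia :=
  repeat match goal with
  | H : context [essential _ _ _ _] |- _ => clear H
  | H : context [in_mem _ _] |- _ => clear H
  | H : is_true (~~ _) |- _ => clear H
  end;
  repeat match goal with
  | H : context [mult ?e ?t ?X] |- _ =>
      let k := fresh "k" in generalize dependent (mult e t X) => k
  | |- context [mult ?e ?t ?X] =>
      let k := fresh "k" in generalize dependent (mult e t X) => k
  end; intros; lia.

Section MatchingTheory.
Variables (R : realType) (theta : R) (T : finType) (e : rel T).
Hypotheses (e_sym : symmetric e) (e_irr : irreflexive e).
Implicit Types (S C X : {set T}) (u v w y z : T) (M : {set {set T}}).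
Local Notation mu := (@matching_poly T e R).
Local Notation m := (mult e theta).
Local Notation ess := (essential e theta).
Local Notation d := ('X - theta%:P).

(** * The recursion for the matching polynomial *)

Lemma edgesP S E :
  reflect (exists x y, [/\ x \in S, y \in S, e x y & E = [set x; y]])
          (E \in edges e S).
Proof.
apply: (iffP imset2P) => [[x y xS]|[x [y [xS yS exy ->]]]].
  by rewrite inE => /andP[yS exy] ->; exists x, y.
by exists x y; rewrite ?inE ?yS.
Qed.

Lemma edges_through S u E : E \in edges e S -> u \in E ->
  exists v, [/\ v \in S, e u v & E = [set u; v]].
Proof.
move=> /edgesP[x [y [xS yS exy ->]]]; rewrite !inE => /orP[] /eqP->.
  by exists y.
by exists x; rewrite e_sym setUC.
Qed.

Lemma matching_edge S M E : is_matching e S M -> E \in M -> E \in edges e S.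
Proof. by case/andP=> /subsetP sM _ /sM. Qed.

Lemma matching_inj S M E F x :
  is_matching e S M -> E \in M -> F \in M -> x \in E -> x \in F -> E = F.
Proof.
move=> /andP[_ /trivIsetP tM] EM FM xE xF; apply/eqP/negPn/negP => nEF.
by move/pred0P: (tM _ _ EM FM nEF) => /(_ x) /=; rewrite xE xF.
Qed.

Lemma cover_matching S M : is_matching e S M -> cover M \subset S.
Proof.
move=> mM; apply/subsetP => x /bigcupP[E /(matching_edge mM)].
by move=> /edgesP[a [b [aS bS _ ->]]]; rewrite !inE => /orP[] /eqP->.
Qed.

Lemma card_matching S M : is_matching e S M -> (2 * #|M| <= #|S|)%N.
Proof.
move=> mM; apply: leq_trans (subset_leq_card (cover_matching mM)).
case/andP: (mM) => _ /eqP <-; rewrite mulnC -sum_nat_const.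
apply: leq_sum => E /(matching_edge mM) /edgesP[a [b [_ _ eab ->]]].
by rewrite cards2; case: eqVneq eab => [->|//]; rewrite e_irr.
Qed.

Lemma matching_polyE S : mu S =
  \sum_(M | is_matching e S M) (-1) ^+ #|M| *: 'X^(#|S| - 2 * #|M|).
Proof.
rewrite (partition_big (fun M => inord #|M| : 'I_(#|S| %/ 2).+1) predT) //=.
apply: eq_bigr => r _.
rewrite (eq_bigl (fun M => M \in
  [set M | is_matching e S M & #|M| == r])); last first.
  move=> M; rewrite inE; case mM: (is_matching e S M) => //=.
  by rewrite -val_eqE /= inordK // ltnS leq_divRL // mulnC card_matching.
rewrite (eq_bigr (fun=> (-1) ^+ r *: 'X^(#|S| - 2 * r))).
  by rewrite sumr_const -scaler_nat scalerA mulrC.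
by move=> M; rewrite inE => /andP[_ /eqP->].
Qed.

Lemma edge_setD1 S u E :
  (E \in edges e (S :\ u)) = (E \in edges e S) && (u \notin E).
Proof.
apply/edgesP/andP => [[x [y [/setD1P[xu xS] /setD1P[yu yS] exy ->]]]|].
  split; first by apply/edgesP; exists x, y.
  by rewrite !inE negb_or ![u == _]eq_sym xu.
move=> [/edgesP[x [y [xS yS exy ->]]]]; rewrite !inE negb_or => /andP[ux uy].
by exists x, y; rewrite !inE xS yS ![_ == u]eq_sym ux uy.
Qed.

Lemma matching_setD1 S u M :
  is_matching e (S :\ u) M = is_matching e S M && (u \notin cover M).
Proof.
rewrite /is_matching andbAC; congr andb.
apply/subsetP/andP => [sM|[/subsetP sM uM] E EM].
  split; first by apply/subsetP => E /sM; rewrite edge_setD1 => /andP[].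
  by apply/bigcupP => -[E /sM]; rewrite edge_setD1 => /andP[_ /negP].
rewrite edge_setD1 sM //=; apply: contra uM => uE; apply/bigcupP; by exists E.
Qed.

Lemma matching_add_edge S u v M : u \in S -> v \in S -> e u v ->
  is_matching e (S :\ u :\ v) M =
  [&& is_matching e S ([set u; v] |: M) & [set u; v] \notin M].
Proof.
move=> uS vS euv; rewrite !matching_setD1 -andbA.
have uvE : [set u; v] \in edges e S by apply/edgesP; exists u, v.
apply/idP/idP => [/and3P[mM uM vM]|/andP[mM uvM]].
  have nM : [set u; v] \notin M.
    apply: contra uM => uvM.
    by apply/bigcupP; exists [set u; v]; rewrite ?set21.
  rewrite nM andbT /is_matching subUset sub1set uvE /=.
  have [-> /trivIsetP tM] := andP mM.
  have dis E : E \in M -> [disjoint [set u; v] & E].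
    move=> EM; rewrite disjoint_subset; apply/subsetP => x.
    rewrite !inE => /orP[] /eqP->.
      by apply: contra uM => ?; apply/bigcupP; exists E.
    by apply: contra vM => ?; apply/bigcupP; exists E.
  apply/trivIsetP => E F /setU1P[->|EM] /setU1P[->|FM] nEF.
  - by rewrite eqxx in nEF.
  - exact: dis.
  - by rewrite disjoint_sym dis.
  - exact: tM.
have {mM} mM' := mM.
have mM : is_matching e S M.
  have [/subsetP sM /trivIsetP tM] := andP mM'.
  apply/andP; split; first by apply/subsetP => E EM; rewrite sM // inE EM orbT.
  by apply/trivIsetP => E F EM FM; apply: tM; rewrite inE ?EM ?FM orbT.
have out x : x \in [set u; v] -> x \notin cover M.
  move=> xuv; apply/bigcupP => -[E EM xE].
  have E' : E = [set u; v].
    by apply: (matching_inj mM' _ _ xE xuv); rewrite !inE ?eqxx ?EM ?orbT.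
  by rewrite -E' EM in uvM.
by rewrite mM !out ?set21 ?set22.
Qed.

(** The matchings of S that leave u uncovered are the matchings of S :\ u; the
    others are the unions of an edge at u, say to v, with a matching of
    S :\ u :\ v. *)
Theorem mu_rec S u : u \in S ->
  mu S = 'X * mu (S :\ u) - \sum_(v in S | e u v) mu (S :\ u :\ v).
Proof.
move=> uS; rewrite matching_polyE (bigID (fun M => u \notin cover M)) /=.
have cS : #|S| = #|S :\ u|.+1 by rewrite (cardsD1 u S) uS.
congr (_ + _).
  under eq_bigl do rewrite -matching_setD1.
  rewrite matching_polyE mulr_sumr; apply: eq_bigr => M mM.
  rewrite -scalerAr -exprS; congr (_ *: 'X^_).
  by rewrite cS subSn // card_matching.
pose partner M := odflt u [pick v | [set u; v] \in M].
have partnerP M : is_matching e S M -> ~~ (u \notin cover M) ->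
    [/\ partner M \in S, e u (partner M) & [set u; partner M] \in M].
  move=> mM /negPn/bigcupP[E EM uE].
  have [v [vS euv Ev]] := edges_through (matching_edge mM EM) uE.
  rewrite /partner; case: pickP => [w wM|/(_ v)]; last by rewrite -Ev EM.
  have [x [xS eux wx]] := edges_through (matching_edge mM wM) (set21 u w).
  rewrite wM /=; suff -> : w = x by [].
  have: w \in [set u; x] by rewrite -wx set22.
  rewrite !inE => /orP[/eqP wu|/eqP //].
  have: x \in [set u; w] by rewrite wx set22.
  by rewrite wu !inE orbb => /eqP.
rewrite (partition_big partner (fun v => (v \in S) && e u v)); last first.
  by move=> M /andP[mM uM]; have [-> -> _] := partnerP _ mM uM.
rewrite -sumrN; apply: eq_bigr => v /andP[vS euv].
have uv : v != u by apply: contraTneq euv => ->; rewrite e_irr.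
rewrite matching_polyE -sumrN.
rewrite (reindex_onto (fun M => [set u; v] |: M) (fun M => M :\ [set u; v])).
  apply: eq_big => [M|M].
    rewrite matching_add_edge //.
    have nM : (([set u; v] |: M) :\ [set u; v] == M) = ([set u; v] \notin M).
      apply/eqP/idP => [<-|/setU1K //]; by rewrite !inE eqxx.
    rewrite nM; congr andb; case mM: is_matching => //=.
    have uM : ~~ (u \notin cover ([set u; v] |: M)).
      by apply/negPn/bigcupP; exists [set u; v]; rewrite ?setU11 ?set21.
    rewrite uM /=; have [pS eup pM] := partnerP _ mM uM.
    move: (partner _) => p in pS eup pM *.
    apply/eqP; have: p \in [set u; v].
      have <- := matching_inj mM pM (setU11 _ _) (set21 _ _) (set21 _ _).
      exact: set22.
    rewrite !inE => /orP[/eqP pu|/eqP //].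
    by rewrite pu e_irr in eup.
  move=> /andP[_ /eqP ME].
  have nM : [set u; v] \notin M by rewrite -ME !inE eqxx.
  rewrite cardsU1 nM exprS mulN1r scaleNr; congr (- (_ *: 'X^_)).
  rewrite cS (cardsD1 v (S :\ u)) !inE uv vS; lia.
move=> M /andP[/andP[mM uM] /eqP pv].
by rewrite setD1K //; have [_ _] := partnerP _ mM uM; rewrite pv.
Qed.

Lemma setD1C S u v : S :\ u :\ v = S :\ v :\ u.
Proof. by rewrite !setDDl setUC. Qed.

Lemma adj_setD1 S u v : v \in S -> e u v -> v \in S :\ u.
Proof.
move=> vS euv; rewrite !inE vS andbT.
by apply: contraTneq euv => ->; rewrite e_irr.
Qed.

Lemma sumD1 S w (P : pred T) (F : T -> {poly R}) :
  \sum_(z in S :\ w | P z) F z =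
  \sum_(z in S | P z) if z == w then 0 else F z.
Proof.
rewrite big_mkcond [RHS]big_mkcond; apply: eq_bigr => z _.
by rewrite !inE; case: (z == w); rewrite //= if_same.
Qed.

Lemma mu0 : mu set0 = 1.
Proof.
rewrite matching_polyE // (big_pred1 set0) ?cards0 ?scale1r // => M.
rewrite /=; apply/idP/eqP => [mM|->]; last first.
  by rewrite /is_matching sub0set /trivIset /cover !big_set0 cards0.
have := card_matching mM; rewrite cards0 leqn0 muln_eq0 /=.
by rewrite cards_eq0 => /eqP.
Qed.

Lemma size_mu S : size (mu S) = #|S|.+1.
Proof.
have [n] := ubnP #|S|; elim: n S => // n IHn S ltSn.
have [->|[u uS]] := set_0Vmem S; first by rewrite mu0 size_poly1 cards0.
have cS : #|S| = #|S :\ u|.+1 by rewrite (cardsD1 u S) uS.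
have sX : size ('X * mu (S :\ u)) = #|S|.+1.
  have sSu : size (mu (S :\ u)) = #|S| by rewrite IHn -?cS //; lia.
  by rewrite mulrC size_mulX ?sSu // -size_poly_eq0 sSu cS.
rewrite (mu_rec uS) size_polyDl // size_polyN sX.
apply: leq_ltn_trans (size_sum _ _ _) _; rewrite ltnS.
apply/bigmax_leqP => v /andP[vS euv].
have uv : v != u by apply: contraTneq euv => ->; rewrite e_irr.
have := cardsD1 v (S :\ u); rewrite !inE uv vS /= => cSu.
by rewrite IHn; lia.
Qed.

Lemma mu_neq0 S : mu S != 0.
Proof. by rewrite -size_poly_eq0 size_mu. Qed.

(** Being 0 on the diagonal, mu2 lets the sums over neighbours in mu_rec_del,
    path_sqr_rec and path_cross_rec run over all neighbours. *)
Definition mu2 S u v := if u == v then 0 else mu (S :\ u :\ v).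

Lemma mu_rec_del S u v : u \in S -> u != v ->
  mu (S :\ v) = 'X * mu (S :\ u :\ v) -
                \sum_(z in S | e u z) mu2 (S :\ u) z v.
Proof.
move=> uS uv; rewrite (mu_rec (_ : u \in S :\ v)) ?inE ?uv //.
rewrite sumD1 setD1C; congr (_ - _); apply: eq_bigr => z _.
by rewrite /mu2; case: eqP => // _; rewrite [in RHS]setD1C.
Qed.

(** Expand both sides at one vertex u and compare the terms by induction. *)
Lemma deriv_mu S : (mu S)^`() = \sum_(u in S) mu (S :\ u).
Proof.
have [n] := ubnP #|S|; elim: n S => // n IHn S ltSn.
have [->|[u uS]] := set_0Vmem S; first by rewrite mu0 derivC big_set0.
have cS : #|S| = #|S :\ u|.+1 by rewrite (cardsD1 u S) uS.
rewrite (mu_rec uS) derivB derivM derivX mul1r [X in _ - X]raddf_sum /=.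
rewrite (big_setD1 u uS) /= IHn; last lia.
rewrite -addrA; congr (_ + _).
under [in RHS]eq_bigr => w.
  rewrite !inE => /andP[wu wS].
  rewrite (@mu_rec_del S u w) // 1?eq_sym //.
  over.
rewrite /= sumrB -mulr_sumr; congr (_ - _); rewrite exchange_big /=.
apply: eq_bigr => v /andP[vS euv].
have uv : v != u by apply: contraTneq euv => ->; rewrite e_irr.
have cSu : #|S :\ u| = #|S :\ u :\ v|.+1.
  by rewrite (cardsD1 v (S :\ u)) !inE uv vS.
rewrite IHn; last lia.
rewrite [RHS](big_setD1 v) ?inE ?uv //= /mu2 eqxx add0r.
by apply: eq_bigr => w; rewrite !inE eq_sym => /andP[/negbTE ->].
Qed.

(** * Sums of squares over paths *)

(** For u and v in S this is the sum of mu (S :\: P) ^+ 2 over the paths P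
    from u to v in S; path_sqr_rec splits off the first edge of P. *)
Definition path_sqr S u v := mu (S :\ u) * mu (S :\ v) - mu S * mu2 S u v.

(** For distinct u, v, w in S this is twice the sum of mu (S :\: P) *
    mu (S :\: P :\ w) over the paths P from u to v in S that avoid w. It
    arises from path_sqr S u v and path_sqr (S :\ w) u v by polarization. *)
Definition path_cross S u v w :=
  mu (S :\ u) * mu (S :\ v :\ w) + mu (S :\ v) * mu2 S u w -
  mu S * (if u == w then 0 else mu2 (S :\ w) u v) - mu (S :\ w) * mu2 S u v.

Lemma path_sqr_diag S u : path_sqr S u u = mu (S :\ u) ^+ 2.
Proof. by rewrite /path_sqr /mu2 eqxx mulr0 subr0. Qed.

Lemma path_sqr_rec S u v : u \in S -> u != v ->
  path_sqr S u v = \sum_(z in S | e u z) path_sqr (S :\ u) z v.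
Proof.
move=> uS uv; rewrite /path_sqr sumrB -mulr_suml -mulr_sumr.
have -> : mu2 S u v = mu (S :\ u :\ v) by rewrite /mu2 (negbTE uv).
rewrite (@mu_rec_del S u v) // (mu_rec uS).
rewrite mulrBr mulrBl; ring.
Qed.

Lemma path_sqr_sos S u v : u \in S -> gram (path_sqr S u v) 0 0.
Proof.
have [n] := ubnP #|S|; elim: n S u => // n IHn S u ltSn uS.
have [->|uv] := eqVneq u v.
  by rewrite path_sqr_diag; apply: (gram_sos (gram_sqr _ 0)).
rewrite path_sqr_rec //; have := cardsD1 u S; rewrite uS => cS.
apply: sos_sum => z /andP[zS euz].
by apply: IHn; [lia|exact: adj_setD1].
Qed.

(** The edge from u to v is one of the paths from u to v. *)
Lemma path_sqr_adj S u v : u \in S -> v \in S -> e u v ->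
  exists2 p, gram p 0 0 & path_sqr S u v = mu (S :\ u :\ v) ^+ 2 + p.
Proof.
move=> uS vS euv.
have uv : u != v by apply: contraTneq euv => ->; rewrite e_irr.
rewrite path_sqr_rec // (bigD1 v) ?vS //= path_sqr_diag.
exists (\sum_(z in S | e u z && (z != v)) path_sqr (S :\ u) z v); last first.
  by congr (_ + _); apply: eq_bigl => z; rewrite andbA.
apply: sos_sum => z /and3P[zS euz _]; apply: path_sqr_sos.
exact: adj_setD1.
Qed.

Lemma path_sqr_del S w v : w != v -> path_sqr (S :\ w) w v = 0.
Proof.
by move=> wv; rewrite /path_sqr /mu2 (negbTE wv) setDDl setUid subrr.
Qed.

Lemma path_cross_rec S u v w : u \in S -> u != v -> u != w -> v != w ->
  path_cross S u v w = \sum_(z in S | e u z) path_cross (S :\ u) z v w.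
Proof.
move=> uS uv uw vw; rewrite /path_cross !sumrB big_split /=.
rewrite -!mulr_suml -!mulr_sumr.
have -> : mu2 S u v = mu (S :\ u :\ v) by rewrite /mu2 (negbTE uv).
have -> : mu2 S u w = mu (S :\ u :\ w) by rewrite /mu2 (negbTE uw).
have -> : mu2 (S :\ w) u v = mu (S :\ w :\ u :\ v) by rewrite /mu2 (negbTE uv).
rewrite (negbTE uw).
rewrite (mu_rec uS) (@mu_rec_del S u v) //.
rewrite (@mu_rec_del S u w) //.
rewrite [S :\ v :\ w]setD1C (@mu_rec_del (S :\ w) u v) ?inE ?uw //.
rewrite sumD1 ![S :\ w :\ u]setD1C [S :\ u :\ v :\ w]setD1C.
ring.
Qed.

(** The two vectors are indexed by the paths P from u to v, with entries
    mu (S :\: P) and mu (S :\: P :\ w), the latter replaced by 0 if P meets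
    w. *)
Lemma path_gram S u v w : u \in S -> v != w ->
  gram (path_sqr S u v) (path_cross S u v w) (path_sqr (S :\ w) u v).
Proof.
move=> uS vw; have [n] := ubnP #|S|; elim: n S u uS => // n IHn S u uS ltSn.
have [->|uv] := eqVneq u v.
  have -> : path_cross S v v w = mu (S :\ v) * mu (S :\ w :\ v) *+ 2.
    by rewrite /path_cross /mu2 eqxx (negbTE vw) [S :\ v :\ w]setD1C; ring.
  rewrite !path_sqr_diag; exact: gram_sqr.
have [uw|uw] := eqVneq u w.
  have -> : path_cross S u v w = 0.
    by rewrite /path_cross /mu2 uw eqxx eq_sym (negbTE vw) setD1C; ring.
  (* All paths start at w, so the second vector is 0. *)
  by rewrite -uw path_sqr_del //; apply: gram_sos (path_sqr_sos v uS).
rewrite [path_sqr S _ _]path_sqr_rec // path_cross_rec //.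
rewrite path_sqr_rec ?inE ?uw // sumD1.
have cS := cardsD1 u S; rewrite uS in cS.
apply: gram_sum => z /andP[zS euz].
have zSu : z \in S :\ u by apply: adj_setD1.
suff -> : (if z == w then 0 else path_sqr (S :\ w :\ u) z v) =
    path_sqr (S :\ u :\ w) z v.
  by apply: IHn => //; lia.
by rewrite setD1C; case: eqVneq => // ->; rewrite path_sqr_del // eq_sym.
Qed.

(** * Multiplicities under deletion of a vertex *)

Lemma mult_geq n S : (n <= m S)%N = (d ^+ n %| mu S).
Proof. exact/mup_geq/mu_neq0. Qed.

Lemma mult2_geq n S S' : (n <= m S + m S')%N = (d ^+ n %| mu S * mu S').
Proof. by rewrite -mupM ?mup_geq ?mulf_neq0 ?mu_neq0. Qed.

(** As mu' is the sum of the mu (S :\ v), the sum of path_sqr S u v over all v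
    in S is mu (S :\ u) * mu' - mu * (mu (S :\ u))'. Its summand for v = u is
    mu (S :\ u) ^+ 2, so its order at theta is at most twice m (S :\ u); were
    m S at least m (S :\ u) + 2, both products would vanish to a higher
    order. *)
Lemma mult_del_ge S u : u \in S -> (m S <= (m (S :\ u)).+1)%N.
Proof.
move=> uS; rewrite leqNgt; apply/negP => lt_m.
set l := m (S :\ u) in lt_m.
have E : mu (S :\ u) ^+ 2 + \sum_(v in S :\ u) path_sqr S u v =
    mu (S :\ u) * (mu S)^`() - mu S * (mu (S :\ u))^`().
  rewrite !deriv_mu (big_setD1 u uS) /= sumrB mulrDr -expr2 addrA.
  rewrite -mulr_sumr -mulr_sumr; congr (_ - _ * _).
  by apply: eq_bigr => v; rewrite !inE eq_sym /mu2 => /andP[/negbTE ->].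
suff: (l < m (S :\ u))%N by rewrite ltnn.
have dS : d ^+ l.+2 %| mu S by rewrite -mult_geq.
have dSu : d ^+ l %| mu (S :\ u) by rewrite -mult_geq.
have sos : gram (\sum_(v in S :\ u) path_sqr S u v) 0 0.
  by apply: sos_sum => v _; apply: path_sqr_sos.
rewrite mult_geq; apply: (sos_summand_dvd sos); rewrite E; apply: dvdp_sub.
  have -> : l.*2.+1 = (l + l.+1)%N by mult_lia.
  by rewrite exprD dvdp_mul // (dvdp_deriv dS).
apply: dvdp_trans (dvdp_mul dS (dvdp_deriv dSu)).
by rewrite -exprD dvdp_exp2l //; mult_lia.
Qed.

(** By mult_del_ge, theta has multiplicity at least m (S :\ u) - 1 in every
    term of the expansion of mu S at u. *)
Lemma mult_del_le S u : u \in S -> (m (S :\ u) <= (m S).+1)%N.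
Proof.
move=> uS; case E: (m (S :\ u)) => [//|l]; rewrite ltnS mult_geq (mu_rec uS).
apply: dvdp_sub; first by rewrite dvdp_mull // -mult_geq E.
apply: dvdp_sum => v /andP[vS euv].
have vSu : v \in S :\ u by apply: adj_setD1.
by have := mult_del_ge vSu; rewrite E -mult_geq ltnS.
Qed.

Lemma essentialE S u : u \in S -> ess S u = (m (S :\ u) < m S)%N.
Proof.
move=> uS; rewrite /essential uS /=; have := mult_del_ge uS; mult_lia.
Qed.

Lemma essential_in S u : ess S u -> u \in S.
Proof. by case/andP. Qed.

Lemma essential_mult S u : ess S u -> m S = (m (S :\ u)).+1.
Proof. by case/andP=> _ /eqP <-; rewrite addn1. Qed.

(** Otherwise both products in path_sqr S u v vanish at theta to order at least
    2 m (S :\ u) - 1, while the edge from u to v contributes the square of a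
    polynomial of order m (S :\ u) - 1. *)
Lemma positive_of_essential S u v : u \in S -> e u v -> ess (S :\ u) v ->
  m (S :\ u) = (m S).+1.
Proof.
move=> uS euv v_ess; have := mult_del_le uS.
rewrite leq_eqVlt => /orP[/eqP //|le_m].
have [vu vS] : v != u /\ v \in S.
  by have := essential_in v_ess; rewrite !inE => /andP.
have := essential_mult v_ess; set l := m (S :\ u :\ v) => El.
have le_v : (l <= m (S :\ v))%N by have := mult_del_ge vS; mult_lia.
suff: (l < m (S :\ u :\ v))%N by rewrite ltnn.
have [p p_sos Wp] := path_sqr_adj uS vS euv.
rewrite mult_geq; apply: (sos_summand_dvd p_sos); rewrite -Wp.
have mu2E : mu2 S u v = mu (S :\ u :\ v) by rewrite /mu2 eq_sym (negbTE vu).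
by apply: dvdp_sub; rewrite ?mu2E -mult2_geq; mult_lia.
Qed.

(** If no neighbour of u were essential in S :\ u, every term in the expansion
    of mu S at u would have multiplicity at least m (S :\ u). *)
Lemma essential_of_positive S u : u \in S -> m (S :\ u) = (m S).+1 ->
  exists2 v, e u v & ess (S :\ u) v.
Proof.
move=> uS u_pos; have [/exists_inP[v]|no_ess] :=
  boolP [exists v in e u, ess (S :\ u) v]; first by exists v.
suff: (m S < m S)%N by rewrite ltnn.
rewrite mult_geq (mu_rec uS); apply: dvdp_sub.
  by rewrite dvdp_mull // -mult_geq u_pos.
apply: dvdp_sum => v /andP[vS euv].
rewrite -mult_geq -u_pos leqNgt -essentialE ?adj_setD1 //.
by apply: contra no_ess => v_ess; apply/exists_inP; exists v.
Qed.

(** Differentiation lowers a positive multiplicity by exactly one, and the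
    derivative of mu S is the sum of the mu (S :\ u). *)
Lemma exists_essential S : (0 < m S)%N -> exists u, ess S u.
Proof.
case E: (m S) => [//|k] _.
have [/existsP//|no_ess] := boolP [exists u, ess S u].
suff: (k.+2 <= m S)%N by rewrite E ltnn.
rewrite mult_geq dvdp_of_deriv -?mult_geq ?E // deriv_mu.
apply: dvdp_sum => u uS.
rewrite -mult_geq -E leqNgt -essentialE //.
by apply: contra no_ess => u_ess; apply/existsP; exists u.
Qed.

(** If m (S :\ u) = m S and v is not essential in S :\ u, then path_sqr S u v
    has the odd order 2 (m S) - 1 at theta, impossible for a sum of
    squares. *)
Lemma special_positive S u v : u \in S -> ~~ ess S u -> e u v -> ess S v ->
  m (S :\ u) = (m S).+1.
Proof.
move=> uS u_ness euv v_ess; have vS := essential_in v_ess.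
have vSu := adj_setD1 vS euv.
have uv : u != v by move: vSu; rewrite !inE eq_sym => /andP[].
have [v_ess'|] := boolP (ess (S :\ u) v).
  exact: positive_of_essential v_ess'.
rewrite essentialE // -leqNgt => le_uv.
have := mult_del_le uS; rewrite leq_eqVlt => /orP[/eqP //|].
rewrite essentialE // -leqNgt in u_ness => u_le.
have mu_eq : m (S :\ u) = m S by mult_lia.
have mv := essential_mult v_ess.
set k := m (S :\ v) in mv.
have mu2E : mu2 S u v = mu (S :\ u :\ v) by rewrite /mu2 (negbTE uv).
have dW : d ^+ k.*2.+1 %| path_sqr S u v.
  by apply: dvdp_sub; rewrite ?mu2E -mult2_geq; mult_lia.
have := sos_dvd (path_sqr_sos v uS) dW.
rewrite dvdp_subl; last by rewrite mu2E -mult2_geq; mult_lia.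
by rewrite -mult2_geq; mult_lia.
Qed.

(** * Transitivity, stability and Gallai's lemma *)

(** Otherwise put i = m (S :\ y :\ w) = m S - 2. Of the four products in
    path_cross S v y w, the product mu (S :\ v) * mu (S :\ y :\ w) has order
    2i + 1 at theta and the others have order at least 2i + 2. But
    path_sqr S v y and path_sqr (S :\ w) v y have order at least 2i + 1, and
    then gram_dvd gives order at least 2i + 2 for the whole. *)
Lemma nonessential_trans S y v w : ess S y -> ess S v -> ess S w ->
  y != v -> v != w -> y != w ->
  ~~ ess (S :\ y) v -> ~~ ess (S :\ w) v -> ~~ ess (S :\ y) w.
Proof.
move=> y_ess v_ess w_ess yv vw yw.
have yS := essential_in y_ess; have vS := essential_in v_ess.
have wS := essential_in w_ess.
have my := essential_mult y_ess; have mv := essential_mult v_ess.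
have mw := essential_mult w_ess.
have vSy : v \in S :\ y by rewrite !inE eq_sym yv.
have vSw : v \in S :\ w by rewrite !inE vw.
have wSy : w \in S :\ y by rewrite !inE eq_sym yw.
rewrite !essentialE // -!leqNgt => le_yv le_wv; rewrite leqNgt; apply/negP.
move Ei: (m (S :\ y :\ w)) => i lt_yw.
have iE : m (S :\ y) = i.+1 by have := mult_del_ge wSy; mult_lia.
have lt_yvw : (i <= m (S :\ w :\ v :\ y))%N.
  have : y \in S :\ w :\ v by rewrite !inE yv yw.
  by move/mult_del_ge; mult_lia.
have mu2E : mu2 S v y = mu (S :\ y :\ v).
  by rewrite /mu2 eq_sym (negbTE yv) setD1C.
have mu2E2 : mu2 S v w = mu (S :\ w :\ v) by rewrite /mu2 (negbTE vw) setD1C.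
have mu2E3 : mu2 (S :\ w) v y = mu (S :\ w :\ v :\ y).
  by rewrite /mu2 eq_sym (negbTE yv).
have dW : d ^+ i.*2.+1 %| path_sqr S v y.
  by apply: dvdp_sub; rewrite ?mu2E -mult2_geq; mult_lia.
have dWw : d ^+ i.*2.+1 %| path_sqr (S :\ w) v y.
  by apply: dvdp_sub; rewrite ?mu2E3 -?[S :\ w :\ y]setD1C -mult2_geq; mult_lia.
have := gram_dvd (path_gram vS yw) dW dWw.
rewrite /path_cross (negbTE vw) dvdp_subl.
  2: by rewrite mu2E -mult2_geq; mult_lia.
rewrite dvdp_subl; last by rewrite mu2E3 -mult2_geq; mult_lia.
rewrite dvdp_addl; last by rewrite mu2E2 -mult2_geq; mult_lia.
rewrite -mult2_geq Ei; mult_lia.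
Qed.

Lemma nonessential_sym S y w :
  ess S y -> ess S w -> ess (S :\ y) w = ess (S :\ w) y.
Proof.
move=> y_ess w_ess; have [->//|yw] := eqVneq y w.
have [yS wS] := (essential_in y_ess, essential_in w_ess).
rewrite !essentialE ?inE ?yw 1?eq_sym ?yw // setD1C.
by have := essential_mult y_ess; have := essential_mult w_ess; mult_lia.
Qed.

Lemma essential_del_positive S u w :
  u \in S -> m (S :\ u) = (m S).+1 -> ess S w -> ess (S :\ u) w.
Proof.
move=> uS u_pos w_ess; have mw := essential_mult w_ess.
have wu : w != u.
  by apply: contraTneq w_ess => ->; rewrite essentialE //; mult_lia.
have wS := essential_in w_ess.
rewrite essentialE ?inE ?wu // setD1C.
have : u \in S :\ w by rewrite !inE eq_sym wu.
by move/mult_del_le; mult_lia.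
Qed.

(** Let v be an essential neighbour of u. Since u is positive in S :\ v, it
    has a neighbour y essential in S :\ u :\ v; so v and y are essential but
    unrelated in S :\ u. By transitivity w cannot be related to both. *)
Theorem stability S u w : special e theta S u ->
  ess (S :\ u) w = ess S w.
Proof.
move=> /and3P[uS u_ness /existsP[v /andP[euv v_ess]]].
have u_pos := special_positive uS u_ness euv v_ess.
apply/idP/idP => [w_ess|]; last exact: essential_del_positive.
have [->//|wv] := eqVneq w v.
have [wu wS] : w != u /\ w \in S.
  by have := essential_in w_ess; rewrite !inE => /andP.
have vS := essential_in v_ess.
have v_essH := essential_del_positive uS u_pos v_ess.
have mv := essential_mult v_ess; have mvH := essential_mult v_essH.
have uv : u != v by have := essential_in v_essH; rewrite !inE eq_sym => /andP[].
have [y euy y_ess] : exists2 y, e u y & ess (S :\ u :\ v) y.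
  rewrite setD1C; apply: essential_of_positive; first by rewrite !inE uv.
  by rewrite setD1C; mult_lia.
(* A neighbour z of u essential in S :\ u :\ w makes u positive in S :\ w. *)
suff [z euz z_ess] : exists2 z, e u z & ess (S :\ u :\ w) z.
  rewrite setD1C in z_ess.
  have uSw : u \in S :\ w by rewrite !inE eq_sym wu.
  have := positive_of_essential uSw euz z_ess.
  by rewrite essentialE // setD1C; have := essential_mult w_ess; mult_lia.
have [vw_ess|vw_ness] := boolP (ess (S :\ u :\ w) v); first by exists v.
have yH : y \in S :\ u.
  by have := essential_in y_ess; rewrite !inE => /and3P[_ -> ->].
have yv : y != v.
  by have := essential_in y_ess; rewrite !inE => /and3P[->].
have y_essH : ess (S :\ u) y.
  rewrite essentialE //; have := essential_mult y_ess.
  rewrite [S :\ u :\ v :\ y]setD1C.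
  have : v \in S :\ u :\ y by move: vS; rewrite !inE eq_sym yv eq_sym uv => ->.
  by move/mult_del_ge; mult_lia.
exists y => //; apply: contraT => yw_ness.
have wy : w != y.
  by apply: contraNneq vw_ness => ->; rewrite nonessential_sym.
move: (nonessential_trans v_essH w_ess y_essH); rewrite eq_sym wv wy eq_sym yv.
rewrite nonessential_sym // vw_ness nonessential_sym // yw_ness y_ess; exact.
Qed.

(** Were y essential in S :\ x, its neighbour x would be positive in S. *)
Lemma nonessential_adj S x y : ess S x -> ess S y -> e x y -> ~~ ess (S :\ x) y.
Proof.
move=> x_ess y_ess exy.
apply/negP => /(positive_of_essential (essential_in x_ess) exy).
by have := essential_mult x_ess; mult_lia.
Qed.

(** Connectedness, in the form of induction along paths. *)
Definition connected C := forall (Q : pred T) x, x \in C -> Q x ->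
  (forall a b, a \in C -> b \in C -> e a b -> Q a -> Q b) ->
  forall y, y \in C -> Q y.

(** By transitivity along paths, no vertex is essential in C :\ x, so
    exists_essential leaves m (C :\ x) = 0. *)
Theorem gallai C x : connected C -> x \in C ->
  (forall y, y \in C -> ess C y) -> m C = 1%N.
Proof.
move=> C_conn xC all_ess; have x_ess := all_ess _ xC.
have x_rel y : y \in C -> ~~ ess (C :\ x) y.
  move: y; apply: (C_conn (fun y => ~~ ess (C :\ x) y) x) => //.
    by apply/negP => /essential_in; rewrite !inE eqxx.
  move=> a b aC bC eab a_rel.
  have [a_ess b_ess] := (all_ess _ aC, all_ess _ bC).
  have [xb|xb] := eqVneq x b.
    by rewrite xb; apply/negP => /essential_in; rewrite !inE eqxx.
  have [xa|xa] := eqVneq x a.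
    by rewrite xa in xb *; apply: nonessential_adj.
  apply: (nonessential_trans (v := a)) => //.
    by apply: contraTneq eab => ->; rewrite e_irr.
  by apply: nonessential_adj; rewrite // e_sym.
have mx := essential_mult x_ess.
case E: (m (C :\ x)) => [|k]; first by rewrite mx E.
have [|y y_ess] := @exists_essential (C :\ x); first by rewrite E.
have yC : y \in C by have := essential_in y_ess; rewrite !inE => /andP[].
by rewrite (negbTE (x_rel _ yC)) in y_ess.
Qed.

(** * Components *)

Definition closed_in S C :=
  C \subset S /\ forall x y, x \in C -> y \in S -> e x y -> y \in C.

(** Both sides satisfy the recursion at the vertices of C. *)
Lemma mu_split S C : closed_in S C -> mu S = mu C * mu (S :\: C).
Proof.
have [n] := ubnP #|C|; elim: n C S => // n IHn C S ltCn [CS clC].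
have [->|[u uC]] := set_0Vmem C; first by rewrite setD0 mu0 mul1r.
have uS := subsetP CS _ uC.
have clD v S' C' : closed_in S' C' -> v \in C' -> closed_in (S' :\ v) (C' :\ v).
  move=> [C'S' clC'] vC'; split; first exact: setSD.
  by move=> x y /setD1P[xv xC'] /setD1P[yv yS'] exy; rewrite !inE yv (clC' x).
have DD v S' C' : v \in C' -> (S' :\ v) :\: (C' :\ v) = S' :\: C'.
  move=> vC'; apply/setP => x; rewrite !inE.
  by case: eqVneq => [->|//]; rewrite vC'.
have cC := cardsD1 u C; rewrite uC in cC.
have clu : closed_in (S :\ u) (C :\ u) by apply: clD.
rewrite (mu_rec uS) (mu_rec uC) mulrBl (IHn _ _ _ clu) ?DD //; last by mult_lia.
rewrite mulrA; congr (_ - _); rewrite mulr_suml.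
rewrite (eq_bigl (fun v => (v \in C) && e u v)); last first.
  move=> v; apply/andP/andP => -[vX euv]; split=> //; first exact: (clC u).
  exact: (subsetP CS).
apply: eq_bigr => v /andP[vC euv].
have vCu : v \in C :\ u by apply: adj_setD1.
rewrite (IHn (C :\ u :\ v)) ?DD //; last exact: clD.
by have := cardsD1 v (C :\ u); rewrite vCu; mult_lia.
Qed.

Lemma mult_split S C : closed_in S C -> m S = (m C + m (S :\: C))%N.
Proof. by move=> clC; rewrite /mult (mu_split clC) mupM ?mu_neq0. Qed.

Lemma essential_component S C u : closed_in S C -> u \in C -> ess S u = ess C u.
Proof.
move=> clC uC; have uS := subsetP clC.1 _ uC.
have clu : closed_in (S :\ u) (C :\ u).
  split; first exact: setSD clC.1.
  move=> x y /setD1P[xu xC] /setD1P[yu yS] exy.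
  by rewrite !inE yu (clC.2 x).
rewrite !essentialE // (mult_split clC) (mult_split clu).
have -> : (S :\ u) :\: (C :\ u) = S :\: C.
  by apply/setP => x; rewrite !inE; case: eqVneq => [->|//]; rewrite uC.
by rewrite ltn_add2r.
Qed.

Lemma mult_cover (P : {set {set T}}) : trivIset P ->
  (forall C, C \in P -> closed_in (cover P) C) ->
  m (cover P) = (\sum_(C in P) m C)%N.
Proof.
have [n] := ubnP #|P|; elim: n P => // n IHn P ltPn tP clP.
have [->|[C CP]] := set_0Vmem P.
  by rewrite /cover !big_set0 /mult mu0 mupNroot // root1.
have cP := cardsD1 C P; rewrite CP in cP.
rewrite (mult_split (clP _ CP)) -coverD1 // (big_setD1 C CP) /=.
congr (_ + _)%N; apply: IHn; [by rewrite cP in ltPn|exact: trivIsetD|].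
move=> D DP; have [_ clD] := clP D (subsetP (subsetDl _ _) _ DP).
split; first exact: bigcup_sup.
move=> x y xD yP exy; apply: (clD x) => //.
by move: yP; rewrite coverD1 // => /setDP[].
Qed.

Local Notation comps S := (components e S).

Lemma adj_in_sym S : symmetric (adj_in e S).
Proof. by move=> x y; rewrite /adj_in /= e_sym andbCA. Qed.

Lemma components_partition S : partition (comps S) S.
Proof.
apply: equivalence_partitionP => x y z _ _ _; split; first exact: connect0.
move=> cxy; apply/idP/idP; apply: connect_trans => //.
by rewrite (sym_connect_sym (@adj_in_sym S)).
Qed.

Lemma componentsP S C : C \in comps S ->
  exists2 x, x \in S & C = [set y in S | connect (adj_in e S) x y].
Proof. by case/imsetP => x xS ->; exists x. Qed.

Lemma component_closed S C : C \in comps S -> closed_in S C.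
Proof.
move=> /componentsP[r _ ->]; split.
  by apply/subsetP => x; rewrite inE => /andP[].
move=> x y; rewrite !inE => /andP[xS crx] yS exy; rewrite yS.
by apply: connect_trans crx (connect1 _); rewrite /adj_in /= xS yS.
Qed.

Lemma component_connected S C : C \in comps S -> connected C.
Proof.
move=> CS; have [CsubS clC] := component_closed CS.
move=> Q x xC Qx step y yC.
have /connectP[p] : connect (adj_in e S) x y.
  have [r _ CE] := componentsP CS; move: xC yC.
  rewrite CE !inE => /andP[_ crx] /andP[_]; apply: connect_trans.
  by rewrite (sym_connect_sym (@adj_in_sym S)).
move=> + yE; rewrite {y}yE in yC *.
elim: p x xC Qx {yC} => [|a p IHp] x xC Qx //= /andP[/and3P[_ aS exa] pa].
have aC : a \in C by apply: clC exa.
by apply: IHp => //; apply: step exa Qx.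
Qed.

Lemma mult_components S : m S = (\sum_(C in comps S) m C)%N.
Proof.
have /and3P[/eqP cS tS _] := components_partition S.
by rewrite -mult_cover ?cS // => C; apply: component_closed.
Qed.

Lemma num_criticalE S :
  num_critical e theta S = (\sum_(C in comps S) critical e theta C)%N.
Proof. by rewrite -big_mkcondr sum1dep_card. Qed.

Lemma num_critical_le S : (num_critical e theta S <= m S)%N.
Proof.
rewrite num_criticalE mult_components; apply: leq_sum => C _.
by rewrite /critical; case: eqP => [->|_]; rewrite ?andbF // leq_b1.
Qed.

(** Without special vertices, being essential passes along edges, so a
    component with m > 0 has only essential vertices and Gallai's lemma
    applies to it. *)
Lemma no_special_mult S : special_set e theta S = set0 ->
  m S = num_critical e theta S.
Proof.
move=> A0; rewrite num_criticalE mult_components; apply: eq_bigr => C CS.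
have clC := component_closed CS.
have [/eqP mC|] := boolP (m C == 0)%N; first by rewrite /critical mC andbF.
rewrite -lt0n => /exists_essential[x x_ess]; have xC := essential_in x_ess.
have all_ess y : y \in C -> ess C y.
  apply: (component_connected CS xC x_ess) => a b aC bC eab a_ess.
  apply: contraT => b_ness; move/setP/(_ b): A0.
  rewrite !inE /special (subsetP clC.1 _ bC) (essential_component clC bC).
  rewrite b_ness /=.
  move/existsP; case; exists a.
  by rewrite e_sym eab (essential_component clC aC).
have mC := gallai (component_connected CS) xC all_ess.
by rewrite /critical mC eqxx andbT; case: forall_inP.
Qed.

(** The hypothesis forces m = 0 on the non-critical components, so a vertex
    adjacent to an essential one lies in a critical component. *)
Lemma no_special_of_mult S : m S = num_critical e theta S ->
  special_set e theta S = set0.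
Proof.
rewrite num_criticalE mult_components => /esym/eqP mE.
apply/eqP/set0Pn => -[u]; rewrite inE => /and3P[uS u_ness /existsP[v]].
move=> /andP[euv v_ess]; have vS := essential_in v_ess.
have /and3P[/eqP cS tS _] := components_partition S.
have /bigcupP[C CS uC] : u \in cover (comps S) by rewrite cS.
have clC := component_closed CS; have vC := clC.2 _ _ uC vS euv.
rewrite (essential_component clC uC) in u_ness.
rewrite (essential_component clC vC) in v_ess.
have crit_le D : D \in comps S -> (critical e theta D <= m D
    ?= iff (nat_of_bool (critical e theta D) == m D))%N.
  move=> _; split=> //.
  by rewrite /critical; case: eqP => [->|_]; rewrite ?andbF // leq_b1.
move: mE; rewrite (leqif_sum crit_le).2 => /forall_inP/(_ C CS).
rewrite (essential_mult v_ess) /critical.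
by case: forall_inP => //= /(_ u uC); rewrite (negbTE u_ness).
Qed.

(** * Special vertices and barriers *)

Lemma special_mult S u : special e theta S u -> m (S :\ u) = (m S).+1.
Proof.
by case/and3P=> uS u_ness /existsP[v /andP[euv]]; apply: special_positive.
Qed.

Lemma special_set_del S u : special e theta S u ->
  special_set e theta (S :\ u) = special_set e theta S :\ u.
Proof.
move=> u_sp; apply/setP => w; rewrite !inE /special !inE.
case: (eqVneq w u) => //= _; rewrite stability //; congr [&& _, _ & _].
by apply: eq_existsb => v; rewrite stability.
Qed.

Lemma special_set_sub S : special_set e theta S \subset S.
Proof. by apply/subsetP => u; rewrite inE => /and3P[]. Qed.

(** Deleting a special vertex u raises m by one and removes exactly u from the
    special set, so induction reduces to the case without special vertices. *)
Theorem special_set_barrier S : barrier e theta S (special_set e theta S).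
Proof.
split; first exact: special_set_sub.
suff: (m S + #|special_set e theta S|)%N =
      num_critical e theta (S :\: special_set e theta S) by mult_lia.
have [n] := ubnP #|special_set e theta S|; elim: n S => // n IHn S ltAn.
have [A0|[u]] := set_0Vmem (special_set e theta S).
  by rewrite A0 setD0 cards0 addn0 no_special_mult.
move=> uA; have u_sp : special e theta S u by rewrite inE in uA.
have cA := cardsD1 u (special_set e theta S); rewrite uA in cA.
have := IHn (S :\ u); rewrite special_set_del // special_mult //.
have -> : (S :\ u) :\: (special_set e theta S :\ u) =
    S :\: special_set e theta S.
  by apply/setP => x; rewrite !inE; case: eqVneq => [->|//]; rewrite u_sp.
by move=> <-; rewrite ?cA; mult_lia.
Qed.

Lemma mult_delset S X : X \subset S -> (m (S :\: X) <= m S + #|X|)%N.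
Proof.
have [n] := ubnP #|X|; elim: n X => // n IHn X ltXn XS.
have [->|[x xX]] := set_0Vmem X; first by rewrite setD0 leq_addr.
have cX := cardsD1 x X; rewrite xX in cX.
have -> : S :\: X = (S :\: (X :\ x)) :\ x.
  by apply/setP => y; rewrite !inE; case: eqVneq => [->|//]; rewrite xX.
have xS : x \in S :\: (X :\ x) by rewrite !inE eqxx (subsetP XS).
have := mult_del_le xS.
have := IHn (X :\ x); rewrite (subset_trans (subsetDl _ _) XS) => IH.
by have {IH} := IH _ isT; mult_lia.
Qed.

(** Deleting all of X raises m by #|X|, the most that #|X| deletions can
    achieve, so each x in X is positive and X :\ x is a barrier of S :\ x. A
    special vertex u outside X stays special in S :\ x: its essential
    neighbour stays essential, and by stability x is not essential in S :\ u,
    which bounds m (S :\ x :\ u) below. By induction u would then lie in X. *)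
Theorem special_set_min S X :
  barrier e theta S X -> special_set e theta S \subset X.
Proof.
move=> [XS XE].
have {XE} : num_critical e theta (S :\: X) = (m S + #|X|)%N by mult_lia.
have [n] := ubnP #|X|; elim: n S X XS => // n IHn S X XS ltXn XE.
have [X0|[x xX]] := set_0Vmem X.
  rewrite no_special_of_mult ?sub0set //.
  by rewrite X0 setD0 cards0 addn0 in XE.
have cX := cardsD1 x X; rewrite xX in cX; have xS := subsetP XS _ xX.
have SXE : (S :\ x) :\: (X :\ x) = S :\: X.
  by apply/setP => y; rewrite !inE; case: eqVneq => [->|//]; rewrite xX.
have XS' : X :\ x \subset S :\ x by apply: setSD.
have mx : m (S :\ x) = (m S).+1.
  have := mult_delset XS'; rewrite SXE.
  have := num_critical_le (S :\: X); have := mult_del_le xS.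
  rewrite XE; mult_lia.
have IH : special_set e theta (S :\ x) \subset X :\ x.
  by apply: IHn => //; rewrite ?SXE ?XE ?mx; mult_lia.
apply/subsetP => u; rewrite inE => u_sp; apply: contraT => uX.
have ux : u != x by apply: contraNneq uX => ->.
suff /(subsetP IH) : u \in special_set e theta (S :\ x).
  by rewrite !inE (negbTE uX) andbF.
have /and3P[uS u_ness /existsP[v /andP[euv v_ess]]] := u_sp.
have uSx : u \in S :\ x by rewrite !inE ux.
rewrite inE /special uSx /=; apply/andP; split; last first.
  by apply/existsP; exists v; rewrite euv essential_del_positive.
have x_ness : ~~ ess (S :\ u) x.
  by rewrite stability // essentialE // mx; mult_lia.
have xSu : x \in S :\ u by rewrite !inE eq_sym ux.
rewrite essentialE // -leqNgt in x_ness.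
by rewrite essentialE // -leqNgt setD1C mx -(special_mult u_sp).
Qed.
End MatchingTheory.

Theorem theorem3p5 (R : realType) (theta : R) (T : finType) (e : rel T)
    (e_sym : symmetric e) (e_irr : irreflexive e) :
  (forall X : {set T}, barrier e theta [set: T] X ->
     special_set e theta [set: T] \subset X) /\
  barrier e theta [set: T] (special_set e theta [set: T]).
Proof.
by split=> [X|]; [exact: special_set_min|exact: special_set_barrier].
Qed.
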